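(* For every positive integer $q$, there is no hidden-Markov finitely dependent $q$-coloring $X=(X_i)_{i\in\mathbb{Z}}$ of $\mathbb{Z}$.
   Context: A stochastic process $X=(X_i)_{i\in\mathbb{Z}}$ is $k$-dependent if the random sequences $(\ldots,X_{i-2},X_{i-1})$ and $(X_{i+k},X_{i+k+1},\ldots)$ are independent of each other, for each $i\in\mathbb{Z}$; it is finitely dependent if it is $k$-dependent for some integer $k$. It is stationary if $(X_i)_{i\in\mathbb{Z}}$ and $(X_{i+1})_{i\in\mathbb{Z}}$ are equal in law. It is a $q$-coloring (of $\mathbb{Z}$) if each $X_i$ takes values in $\{1,\ldots,q\}$ and almost surely $X_i\neq X_{i+1}$ for all $i\in\mathbb{Z}$. A stationary process $X$ is hidden-Markov if there exist a stationary Markov chain $M=(M_i)_{i\in\mathbb{Z}}$ on a finite state space and a deterministic function $f$ such that $X_i=f(M_i)$ for all $i$. *)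

(* Defs.v *)
From HB Require Import structures.
From mathcomp Require Import all_boot all_order all_algebra.
From mathcomp Require Import all_classical all_reals all_analysis.

Set Implicit Arguments.
Unset Strict Implicit.
Unset Printing Implicit Defensive.

Local Open Scope classical_set_scope.
Local Open Scope ring_scope.

(* The sigma-algebra on [J -> E] generated by the coordinate maps. *)
Definition product_sigma (J : Type) (d' : measure_display)
    (E : measurableType d') : set (set (J -> E)) :=
  <<s \bigcup_(j in [set: J])
        preimage_set_system [set: J -> E] (fun x => x j) measurable >>.

Section processes.
Context (d : measure_display) (T : measurableType d) (R : realType)
  (P : probability T R).

Section general_state_space.
Context (d' : measure_display) (E : measurableType d').

Definition trajectory (J : Type) (X : J -> {RV P >-> E}) (t : T) : J -> E :=
  fun j => X j t.

Definition equal_in_law (J : Type) (X Y : J -> {RV P >-> E}) : Prop :=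
  forall A : set (J -> E), product_sigma A ->
    P (trajectory X @^-1` A) = P (trajectory Y @^-1` A).

Definition independent (I J : Type) (X : I -> {RV P >-> E})
    (Y : J -> {RV P >-> E}) : Prop :=
  forall (A : set (I -> E)) (B : set (J -> E)),
    product_sigma A -> product_sigma B ->
    P (trajectory X @^-1` A `&` trajectory Y @^-1` B) =
    (P (trajectory X @^-1` A) * P (trajectory Y @^-1` B))%E.

Definition stationary (X : int -> {RV P >-> E}) : Prop :=
  equal_in_law X (fun i => X (i + 1)).

(* The past (..., X_(i-2), X_(i-1)) is enumerated backwards in time. *)
Definition k_dependent (k : int) (X : int -> {RV P >-> E}) : Prop :=
  forall i : int, independent (fun n : nat => X (i - 1 - n%:Z))
                              (fun n : nat => X (i + k + n%:Z)).

Definition finitely_dependent (X : int -> {RV P >-> E}) : Prop :=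
  exists k : int, k_dependent k X.

(* Only meaningful when [P B] is nonzero. *)
Definition cond_prob (A B : set T) : R := fine (P (A `&` B)) / fine (P B).

(* [M_(i-j) = x j] for all [0 <= j <= n] *)
Definition history (M : int -> {RV P >-> E}) (i : int) (n : nat)
    (x : nat -> E) : set T :=
  [set t | forall j : nat, (j <= n)%N -> M (i - j%:Z) t = x j].

(* Elementary Markov property, appropriate for a countable discrete state
   space; homogeneity in time is not imposed here. *)
Definition markov_chain (M : int -> {RV P >-> E}) : Prop :=
  forall (i : int) (n : nat) (x : nat -> E) (s : E),
    P (history M i n x) <> 0%E ->
    cond_prob [set t | M (i + 1) t = s] (history M i n x) =
    cond_prob [set t | M (i + 1) t = s] [set t | M i t = x 0%N].

End general_state_space.

Definition finite_discrete (d' : measure_display) (S : measurableType d') :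
    Prop :=
  finite_set [set: S] /\ forall A : set S, measurable A.

Definition hidden_markov (d' : measure_display) (E : measurableType d')
    (X : int -> {RV P >-> E}) : Prop :=
  stationary X /\
  exists (d'' : measure_display) (S : measurableType d'')
         (M : int -> {RV P >-> S}) (f : S -> E),
    [/\ finite_discrete S, markov_chain M, stationary M &
        forall (i : int) (t : T), X i t = f (M i t)].

Definition coloring (q : nat) (X : int -> {RV P >-> nat}) : Prop :=
  (forall (i : int) (t : T), (1 <= X i t <= q)%N) /\
  {ae P, forall t : T, forall i : int, X i t <> X (i + 1) t}.

End processes.

(* Main.v *)
Require Import Defs.
From HB Require Import structures.
From mathcomp Require Import all_boot all_order all_algebra.
From mathcomp Require Import all_classical all_reals all_analysis.
From mathcomp Require Import zify ring.
Set Implicit Arguments.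
Unset Strict Implicit.
Unset Printing Implicit Defensive.
Import Order.TTheory GRing.Theory Num.Theory.
Local Open Scope classical_set_scope.
Local Open Scope ring_scope.

(** Let p w be the probability that the coloring shows the word w on a fixed
    interval, and consider the infinite matrix with entries p (x ++ y), indexed
    by words x and y.

    Conditioning on the state of the hidden chain at the boundary between x and
    y writes p (x ++ y) as a sum, over the finitely many states, of a function
    of x times a function of y; so the matrix has finite rank
    ([markov_finite_rank], [hidden_markov_finite_rank]).  Hence it has an
    invertible minor H, with entries p (u_i ++ v_j), of maximal size, and
    p (x ++ y) = p (x ++ v) H^-1 p (u ++ y) for all words x and y
    ([hankel_factor]).  Consequently T w = (p (u_i ++ w ++ v_j)) H^-1 is a
    multiplicative function of the word w: a linear representation of p of
    minimal dimension.

    Minimality turns properties of p into identities between matrices.  Two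
    consecutive letters are never equal, so T a ^ 2 = T (a a) = 0 and T a has
    trace 0 for each letter a; thus B, the sum of the T a, has trace 0.  On the
    other hand B ^ m is (sum over |w| = m of p (u_i ++ w ++ v_j)) H^-1, and
    for m larger than the range of dependence this sum is p (u_i) p (v_j).
    So a power of B has rank one and fixes the vector (p (u_i)): B is
    a projection of rank one plus a nilpotent matrix, and its trace is 1
    ([mxtrace_rank1_power]).  This contradiction is
    [no_finite_rank_coloring]. *)

(** * Traces of nilpotent matrices and of roots of rank-one projections *)

(** 'X - A divides 'X^m - A^m = 'X^m as matrices over the polynomials, so the
    characteristic polynomial of A divides a power of 'X. *)
Lemma mxtrace_nilpotent (F : fieldType) (n m : nat) (A : 'M[F]_n) :
  A ^+ m = 0 -> \tr A = 0.
Proof.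
move=> Am0; case: n A Am0 => [|n] A Am0.
  by rewrite /mxtrace big_ord0.
have Xm : char_poly A %| 'X^(m * n.+1).
  have comm_XA : GRing.comm ('X%:M : 'M[{poly F}]_n.+1) (map_mx polyC A).
    exact: comm_scalar_mx.
  have := subrXX_comm m comm_XA.
  rewrite -rmorphXn/= -[in X in _ - X]rmorphXn/= Am0 map_mx0 subr0 => XE.
  apply/dvdpP; eexists; rewrite mulrC exprM -det_scalar XE.
  by rewrite -[LHS]/(\det (_ *m _)) det_mulmx.
have /dvdp_exp_XsubCP[k _ eqXk] : char_poly A %| ('X - 0%:P) ^+ (m * n.+1).
  by rewrite subr0.
have {eqXk} : char_poly A = 'X^k.
  apply/eqP; rewrite -eqp_monic ?char_poly_monic ?monicXn//.
  by rewrite subr0 in eqXk.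
move=> charE; have := size_char_poly A.
rewrite charE size_polyXn => -[kE].
have := @char_poly_trace _ n.+1 A isT.
by rewrite charE coefXn kE ltn_eqF//= => /esym/eqP; rewrite oppr_eq0 => /eqP.
Qed.

(** Since B e = e and (e y) B = e y, the powers of B - e y are the B^l - e y, so
    that B - e y is nilpotent, and tr B = tr (e y) = y e. *)
Lemma mxtrace_rank1_power (F : fieldType) (n m : nat) (B : 'M[F]_n)
    (e : 'cV[F]_n) (y : 'rV[F]_n) :
  B *m e = e -> y *m e = 1%:M -> B ^+ m.+1 = e *m y -> \tr B = 1.
Proof.
move=> Be ye BK.
have yB : e *m y *m B = e *m y.
  rewrite -BK -[LHS]/(B ^+ m.+1 * B) -exprSr exprS BK.
  by rewrite -[LHS]/(B *m _) mulmxA Be.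
have NX l : (B - e *m y) ^+ l.+1 = B ^+ l.+1 - e *m y.
  elim: l => [|l IH]; first by rewrite !expr1.
  rewrite exprS IH -[LHS]/(_ *m _) mulmxBl !mulmxBr.
  rewrite -[B *m B ^+ l.+1]exprS mulmxA Be.
  have -> : e *m y *m B ^+ l.+1 = e *m y.
    elim: l {IH} => [|l IH]; first by rewrite expr1.
    by rewrite exprSr -[_ * B]/(_ *m B) mulmxA IH.
  by rewrite mulmxA -[e *m y *m e]mulmxA ye mulmx1 subrr subr0.
have : \tr (B - e *m y) = 0.
  by apply: (@mxtrace_nilpotent _ _ m.+1); rewrite NX BK subrr.
by move=> /eqP; rewrite raddfB/= mxtrace_mulC ye mxtrace1 subr_eq0 => /eqP.
Qed.

(** * Functions on words whose Hankel matrix has finite rank *)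

Section finite_rank_words.
Variables (F : fieldType) (A : Type) (p : seq A -> F).

Definition hankel (r c : nat) (u : 'I_r -> seq A) (v : 'I_c -> seq A)
    : 'M[F]_(r, c) :=
  \matrix_(i, j) p (u i ++ v j).

(** Take an invertible Hankel minor of maximal size.  Bordering it with the row
    of x and the column of y gives a singular matrix, so the Schur complement
    p (x ++ y) - p (x ++ v) H^-1 p (u ++ y) vanishes. *)
Lemma hankel_factor (n : nat) (past fut : seq A -> 'I_n -> F) :
  (forall x y, p (x ++ y) = \sum_s past x s * fut y s) ->
  exists r (u v : 'I_r -> seq A), hankel u v \in unitmx /\
    forall x y, (p (x ++ y))%:M = hankel (fun _ : 'I_1 => x) v *m
      invmx (hankel u v) *m hankel u (fun _ : 'I_1 => y).
Proof.
move=> pE.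
(* Minors larger than the rank n are singular, so a maximal size exists. *)
pose Q r := `[< exists u v : 'I_r -> seq A, hankel u v \in unitmx >].
have Q0 : exists r, Q r.
  exists 0; apply/asboolP; exists (fun=> [::]), (fun=> [::]).
  by rewrite unitmxE det_mx00 unitr1.
have Qn r : Q r -> (r <= n)%N.
  move=> /asboolP[u [v Hu]].
  have -> : r = \rank (hankel u v) by rewrite mxrank_unit.
  have -> : hankel u v =
      (\matrix_(i, s) past (u i) s) *m (\matrix_(s, j) fut (v j) s).
    apply/matrixP => i j; rewrite !mxE pE.
    by apply: eq_bigr => s _; rewrite !mxE.
  exact: leq_trans (mxrankM_maxl _ _) (rank_leq_col _).
case: (ex_maxnP Q0 Qn) => r /asboolP[u [v Hu]] rmax.
exists r, u, v; split=> // x y.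
set H := hankel u v in Hu *.
set b := hankel _ v; set c := hankel u _.
apply/eqP; rewrite -subr_eq0; apply: contraT => delta0.
suff : Q (r + 1)%N by move=> /rmax; rewrite addn1 ltnn.
apply/asboolP.
exists (fun i => if fintype.split i is inl i' then u i' else x).
exists (fun j => if fintype.split j is inl j' then v j' else y).
have -> : hankel (fun i => if fintype.split i is inl i' then u i' else x)
    (fun j => if fintype.split j is inl j' then v j' else y) =
    block_mx H c b (p (x ++ y))%:M.
  apply/matrixP => i j; rewrite !mxE.
  case: (fintype.split i) => i'; rewrite !mxE;
  case: (fintype.split j) => j'; rewrite !mxE//.
  by rewrite !ord1 eqxx.
(* Schur complement: with a nonzero lower right block, both triangular factors
   would be invertible. *)
have -> : block_mx H c b (p (x ++ y))%:M =
    block_mx 1%:M 0 (b *m invmx H) 1%:M *m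
    block_mx H c 0 ((p (x ++ y))%:M - b *m invmx H *m c).
  rewrite mulmx_block !mul1mx !mul0mx !addr0 mulmxKV//.
  by rewrite addrC subrK.
rewrite unitmxE det_mulmx det_lblock det_ublock !det1 !mul1r.
rewrite unitrM -unitmxE Hu/=.
set D := (_ - _) in delta0 *.
rewrite det_mx11 unitfE; apply: contraNneq delta0 => D0.
by apply/eqP/matrixP => i j; rewrite !ord1 D0 mxE.
Qed.

Variable letters : seq A.

(** The sum of p (u ++ w ++ v) over the words w of length m; summing one letter
    at a time avoids quantifying over these words. *)
Fixpoint gap_sum (m : nat) (u v : seq A) : F :=
  if m is m'.+1 then \sum_(a <- letters) gap_sum m' (rcons u a) v
  else p (u ++ v).

(** The minimal representation T of p has nilpotent letters, hence their sum B
    has trace 0, while dependence of range at most K.+1 makes B^K.+1 a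
    projection of rank one, which forces trace 1. *)
Theorem no_finite_rank_coloring (n K : nat) (past fut : seq A -> 'I_n -> F) :
  (forall x y, p (x ++ y) = \sum_s past x s * fut y s) ->
  p [::] = 1 ->
  (forall u, \sum_(a <- letters) p (rcons u a) = p u) ->
  (forall a u v, p (u ++ [:: a, a & v]) = 0) ->
  (forall u v, gap_sum K.+1 u v = p u * p v) -> False.
Proof.
move=> /hankel_factor[r [u [v [Hu pE]]]] p1 psum pcol pdep.
set H := hankel u v in Hu pE *.
pose T w := hankel u (fun j => w ++ v j) *m invmx H.
(* T w T w' = T (w w') on all columns of the infinite matrix, and not only on
   those of the v_j. *)
have TM w (c : nat) (z : 'I_c -> seq A) :
    T w *m hankel u z = hankel u (fun j => w ++ z j).
  apply/matrixP => i j.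
  have := pE (u i ++ w) (z j).
  move=> /matrixP/(_ ord0 ord0); rewrite !mxE eqxx mulr1n catA => ->.
  apply: eq_bigr => l _; rewrite !mxE; congr (_ * _).
  by apply: eq_bigr => l' _; rewrite !mxE catA.
pose B := \sum_(a <- letters) T [:: a].
have trB0 : \tr B = 0.
  rewrite raddf_sum/= big1// => a _; apply: (@mxtrace_nilpotent _ _ 2).
  rewrite expr2 -[LHS]/(T [:: a] *m (hankel _ _ *m _)) mulmxA TM/=.
  rewrite [X in X *m _](_ : _ = 0) ?mul0mx//.
  by apply/matrixP => i j; rewrite !mxE pcol.
pose e : 'cV_r := hankel u (fun=> [::]).
pose y : 'rV_r := hankel (fun=> [::]) v *m invmx H.
have Be : B *m e = e.
  rewrite mulmx_suml; under eq_bigr do rewrite TM.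
  apply/matrixP => i j; rewrite summxE !mxE cats0 -psum.
  by apply: eq_bigr => a _; rewrite !mxE cats1.
have ye : y *m e = 1%:M by rewrite -pE p1.
(* Appending w to x amounts to multiplying the coordinates of x by T w. *)
have rowT (x w : seq A) : hankel (fun _ : 'I_1 => x ++ w) v *m invmx H =
    hankel (fun=> x) v *m invmx H *m T w.
  rewrite !mulmxA; congr (_ *m _); apply/matrixP => i j.
  have /matrixP/(_ ord0 ord0) := pE x (w ++ v j).
  rewrite !mxE eqxx mulr1n catA => ->.
  by apply: eq_bigr => l _; rewrite !ord1 !mxE.
have gapE m : forall x z, (gap_sum m x z)%:M =
    hankel (fun=> x) v *m invmx H *m (B ^+ m *m hankel u (fun _ : 'I_1 => z)).
  elim: m => [|m IH] x z; first by rewrite expr0 mul1mx -pE.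
  rewrite /= raddf_sum/=; under eq_bigr do rewrite IH -cats1 rowT.
  rewrite -mulmx_suml -mulmx_sumr exprS -[B * _]/(B *m _) !mulmxA//.
have BK : B ^+ K.+1 = e *m y.
  rewrite -[LHS]mulmx1 -(mulmxV Hu) mulmxA /y mulmxA; congr (_ *m _).
  apply/matrixP => i j.
  have /matrixP/(_ ord0 ord0) := gapE K.+1 (u i) (v j).
  rewrite pdep mxE eqxx mulr1n => gE.
  transitivity (p (u i) * p (v j)); last by rewrite mxE big_ord1 !mxE cats0.
  have rowH : hankel (fun _ : 'I_1 => u i) v = row i H.
    by apply/matrixP => i' j'; rewrite !mxE.
  rewrite rowH -row_mul mulmxV// -row_mul mul1mx in gE.
  by rewrite gE !mxE; apply: eq_bigr => l _; rewrite !mxE.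
have := mxtrace_rank1_power Be ye BK.
by rewrite trB0 => /eqP; rewrite eq_sym oner_eq0.
Qed.
End finite_rank_words.

(** * Events prescribing finitely many coordinates *)

Section constraints.
Context (T E : Type).

Definition event (I : Type) (Y : I -> T -> E) (l : seq (I * pred E)) : set T :=
  [set t | all (fun c => c.2 (Y c.1 t)) l].

Lemma event_cons (I : Type) (Y : I -> T -> E) c l :
  event Y (c :: l) = [set t | c.2 (Y c.1 t)] `&` event Y l.
Proof.
by apply/seteqP; split => t; rewrite /event /= => /andP.
Qed.

Lemma event_cat (I : Type) (Y : I -> T -> E) l1 l2 :
  event Y (l1 ++ l2) = event Y l1 `&` event Y l2.
Proof.
by apply/seteqP; split => t; rewrite /event /= all_cat => /andP.
Qed.

Fixpoint window (i : int) (w : seq (pred E)) : seq (int * pred E) :=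
  if w is B :: w' then (i, B) :: window (i + 1) w' else [::].

(** Prescribes the present first and then goes back in time, in the order in
    which histories of a Markov chain are enumerated. *)
Fixpoint backward (i : int) (w : seq (pred E)) : seq (int * pred E) :=
  if w is B :: w' then (i, B) :: backward (i - 1) w' else [::].

Lemma window_cat i u v :
  window i (u ++ v) = window i u ++ window (i + (size u)%:Z) v.
Proof.
elim: u i => [|B u IH] i /=; first by rewrite addr0.
by rewrite IH -addrA intS.
Qed.

Lemma event_window_rev (Y : int -> T -> E) i u :
  event Y (window (i - (size u)%:Z) u) = event Y (backward (i - 1) (rev u)).
Proof.
elim/last_ind: u i => [//|u B IH] i.
rewrite rev_rcons /= event_cons -IH -cats1 window_cat size_cat /= event_cat.
rewrite setIC addn1 intS opprD addrA subrK; congr (_ `&` _).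
by rewrite event_cons [event _ [::]](_ : _ = setT) ?setIT//; exact/seteqP.
Qed.

End constraints.

Section probability_of_events.
Context (d : measure_display) (T : measurableType d) (R : realType)
  (P : probability T R).

Definition pr (A : set T) : R := fine (P A).

Lemma pr_sum (V : choiceType) (g : T -> V) (e : seq V) (A : set T) :
  uniq e -> measurable A -> (forall z, measurable (g @^-1` [set z])) ->
  (forall t, A t -> g t \in e) ->
  pr A = \sum_(z <- e) pr (A `&` g @^-1` [set z]).
Proof.
move=> + + mg; elim: e A => [|z e IH] A.
  move=> _ _ Ae; rewrite big_nil (_ : A = set0) ?/pr ?measure0//.
  by apply/seteqP; split=> // t /Ae.
move=> /= /andP[ze ue] mA Ae; rewrite big_cons.
have mAz : measurable (A `&` g @^-1` [set z]) by exact: measurableI.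
have mAD : measurable (A `\` g @^-1` [set z]) by exact: measurableD.
have -> : pr A = pr (A `&` g @^-1` [set z]) + pr (A `\` g @^-1` [set z]).
  rewrite /pr -fineD ?fin_num_measure// -measureU//.
    by rewrite setUIDK.
  by apply/seteqP; split=> // t [[_ gt] []].
congr (_ + _); rewrite IH//.
  apply: eq_big_seq => z' z'e; congr (pr _); apply/seteqP; split => t /=.
    by move=> [[]].
  move=> [At gt]; split=> //; split=> // gtz.
  by move: ze; rewrite -gtz gt z'e.
by move=> t [/Ae + gz]; rewrite inE => /orP[/eqP|].
Qed.

Lemma pr_le0 (A B : set T) : measurable A -> measurable B -> A `<=` B ->
  pr B = 0 -> pr A = 0.
Proof.
move=> mA mB AB; rewrite /pr => B0.
have {}B0 : P B = 0%E by rewrite -[LHS]fineK ?fin_num_measure// B0.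
by rewrite (subset_measure0 mA mB AB B0).
Qed.

Context (d' : measure_display) (E : measurableType d').
Hypothesis mE : forall A : set E, measurable A.

Lemma measurable_event (I : Type) (Y : I -> {RV P >-> E}) l :
  measurable (event Y l).
Proof.
elim: l => [|c l IH].
  by rewrite (_ : event _ _ = setT)//; exact/seteqP.
rewrite event_cons; apply: measurableI => //.
exact: (measurable_funPTI (Y c.1) (mE [set` c.2])).
Qed.

Lemma product_sigma_event (J : Type) (l : seq (J * pred E)) :
  product_sigma (event (fun j (x : J -> E) => x j) l).
Proof.
set G := \bigcup_(j in [set: J])
  preimage_set_system [set: J -> E] (fun x => x j) measurable.
rewrite -[product_sigma _]/(measurable (_ : set (g_sigma_algebraType G))).
elim: l => [|c l IH].
  rewrite (_ : event _ _ = setT); first exact: measurableT.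
  by apply/seteqP.
rewrite event_cons; apply: measurableI => //.
apply: (@sub_sigma_algebra _ setT G); exists c.1 => //.
by exists [set` c.2] => //; rewrite setTI.
Qed.

Lemma stationary_event (Y : int -> {RV P >-> E}) l : stationary Y ->
  pr (event Y [seq (c.1 + 1, c.2) | c <- l]) = pr (event Y l).
Proof.
move=> /(_ _ (product_sigma_event l)) /= eqP.
rewrite /pr -[event Y l]/(trajectory Y @^-1` event (fun j x => x j) l) eqP.
congr (fine (P _)); apply/seteqP.
by split=> t; rewrite /event/= all_map.
Qed.

Lemma stationary_window (Y : int -> {RV P >-> E}) w i : stationary Y ->
  pr (event Y (window i w)) = pr (event Y (window 0 w)).
Proof.
move=> sY.
have wS j : pr (event Y (window (j + 1) w)) = pr (event Y (window j w)).
  rewrite -[RHS](stationary_event _ sY); congr (pr (event Y _)).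
  by elim: w j => //= B w IH j; rewrite IH.
elim/int_rect: i => // n IH; first by rewrite intS addrC wS.
by rewrite -wS intS opprD addrAC subrr add0r.
Qed.

(** Finitely many constraints before time i and finitely many from time i + k on
    are, up to renumbering, measurable sets of trajectories of the past and of
    the future that k-dependence speaks of. *)
Lemma k_dependent_event (k : int) (Y : int -> {RV P >-> E}) (i : int)
    (l1 l2 : seq (int * pred E)) :
  k_dependent k Y -> all (fun c => c.1 < i) l1 ->
  all (fun c => i + k <= c.1) l2 ->
  pr (event Y (l1 ++ l2)) = pr (event Y l1) * pr (event Y l2).
Proof.
move=> kY l1i l2i.
pose n1 := [seq (absz (i - 1 - c.1)%R, c.2) | c <- l1].
pose n2 := [seq (absz (c.1 - (i + k))%R, c.2) | c <- l2].
have := kY i _ _ (product_sigma_event n1) (product_sigma_event n2).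
set A1 := (X in P (X `&` _)); set A2 := (X in P (_ `&` X)).
have A1E : A1 = event Y l1.
  apply: funext => t; rewrite /A1 /event /= all_map; congr is_true.
  apply: eq_in_all => -[j B] /(allP l1i)/= ji; congr (B (Y _ t)).
  by rewrite gez0_abs ?subr_ge0 ?ler_subr_addr//; [ring|lia].
have A2E : A2 = event Y l2.
  apply: funext => t; rewrite /A2 /event /= all_map; congr is_true.
  apply: eq_in_all => -[j B] /(allP l2i)/= ji; congr (B (Y _ t)).
  by rewrite gez0_abs; [ring|lia].
rewrite -[X in _ = X -> _]/(P A1 * P A2)%E A1E A2E event_cat /pr => ->.
by rewrite fineM// fin_num_measure//; exact: measurable_event.
Qed.

End probability_of_events.

(** * The Markov property and conditioning on the present *)

Section markov.
Context (d : measure_display) (T : measurableType d) (R : realType)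
  (P : probability T R) (d' : measure_display) (S : measurableType d').
Hypothesis mS : forall A : set S, measurable A.
Variables (e : seq S).
Hypotheses (e_uniq : uniq e) (e_full : forall s, s \in e).
Variable M : int -> {RV P >-> S}.
Hypothesis markovM : markov_chain M.

Let mevent l : measurable (event M l).
Proof. exact: measurable_event. Qed.

Let msingle i z : measurable (M i @^-1` [set z]).
Proof. exact: (measurable_funPTI (M i) (mS _)). Qed.

Local Hint Resolve mevent msingle : core.

Definition transition (i : int) (s t : S) : R :=
  cond_prob P (M (i + 1) @^-1` [set t]) (M i @^-1` [set s]).

Lemma history_event i s x :
  event M (backward i [seq xpred1 z | z <- s :: x]) =
  history M i (size x) (nth s (s :: x)).
Proof.
suff H y j : event M (backward j [seq xpred1 z | z <- y]) =
    [set t | forall n, (n < size y)%N -> M (j - n%:Z) t = nth s y n].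
  by rewrite H.
elim: y j => [|z y IH] j; first by apply/seteqP; split.
rewrite /= event_cons IH; apply/seteqP; split => t /=.
  move=> [/eqP Mj My] [_|n]; first by rewrite subr0.
  by move=> ny; rewrite /= -My// intS opprD addrA.
move=> My; split; first by have := My 0 isT; rewrite subr0 => /= ->.
by move=> n ny; have := My n.+1 ny; rewrite intS opprD addrA.
Qed.

(** The Markov property conditions on a completely known history; here the
    states at times i, ..., i - size x are known and earlier ones are only
    restricted by Bs.  By induction on Bs, summing over the state at the most
    recent time where it is not determined. *)
Lemma markov_step Bs x s i t :
  let A := event M (backward i ([seq xpred1 z | z <- s :: x] ++ Bs)) in
  pr P (A `&` M (i + 1) @^-1` [set t]) = pr P A * transition i s t.
Proof.
elim: Bs x => [|B Bs IH] x A.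
  have mH : measurable (history M i (size x) (nth s (s :: x))).
    by rewrite -history_event.
  rewrite /A cats0 history_event.
  (* For a null history both sides are 0. *)
  have [H0|/eqP H0] := eqVneq (P (history M i (size x) (nth s (s :: x)))) 0%E.
    have pr0 : pr P (history M i (size x) (nth s (s :: x))) = 0.
      by rewrite /pr H0.
    rewrite pr0 mul0r; apply: (pr_le0 _ mH _ pr0).
      exact: measurableI.
    exact: subIsetl.
  rewrite -[transition i s t](markovM t H0) /cond_prob setIC -/(pr P _).
  rewrite mulrC divfK//; apply: contra_not_neq H0.
  by move=> /eqP; rewrite fine_eq0 ?fin_num_measure// => /eqP.
have mA : measurable A by exact: mevent.
(* D z replaces the constraint B at time j by the single state z. *)
pose D z := event M (backward i
  ([seq xpred1 z | z <- s :: rcons x z] ++ Bs)).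
pose j := i - (size x).+1%:Z.
have AE z : A `&` M j @^-1` [set z] = if B z then D z else set0.
  have backE v w k : event M (backward k (v ++ w)) =
      event M (backward k v) `&` event M (backward (k - (size v)%:Z) w).
    elim: v k => [|C v IHv] k /=.
      by rewrite subr0 [event _ [::]](_ : _ = setT) ?setTI//; exact/seteqP.
    by rewrite !event_cons IHv setIA intS opprD addrA.
  rewrite /A /D -rcons_cons map_rcons cat_rcons !backE size_map /= -/j.
  rewrite !event_cons/=; apply/seteqP; case: ifPn => Bz; split => t' //=.
  - by move=> [[h [_ h']] Mj]; do !split => //; exact/eqP.
  - by move=> [h [/eqP Mj h']]; do !split => //; rewrite Mj.
  - by move=> [[_ [+ _]] Mj]; rewrite Mj (negbTE Bz).
rewrite (pr_sum (g := M j) P e_uniq)//; last exact: measurableI.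
rewrite (pr_sum (g := M j) P e_uniq mA)// mulr_suml; apply: eq_bigr => z _.
rewrite setIAC AE; case: ifP => _; first exact: IH.
by rewrite set0I /pr measure0 mul0r.
Qed.

(** The probability of the future w given the state s at time i; the backward
    equation serves as definition, so that no conditioning on null events
    occurs. *)
Fixpoint future (i : int) (w : seq (pred S)) (s : S) : R :=
  if w is B :: w' then
    \sum_(t <- e | B t) transition i s t * future (i + 1) w' t
  else 1.

Lemma markov_future w i s Bs :
  let A := event M (backward i (xpred1 s :: Bs)) in
  pr P (A `&` event M (window (i + 1) w)) = pr P A * future i w s.
Proof.
elim: w i s Bs => [|B w IH] i s Bs A.
  by rewrite mulr1 [event _ [::]](_ : _ = setT) ?setIT//; exact/seteqP.
have mA : measurable A by exact: mevent.
rewrite (pr_sum (g := M (i + 1)) P e_uniq)//; last exact: measurableI.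
rewrite /= mulr_sumr [RHS]big_mkcond; apply: eq_bigr => z _.
rewrite event_cons; case: ifPn => Bz; last first.
  rewrite (_ : _ `&` _ = set0) ?/pr ?measure0//.
  apply/seteqP; split => // t [[_ [/= Bt _]] Mt].
  by rewrite -Mt Bt in Bz.
have AE : event M (backward (i + 1) [:: xpred1 z, xpred1 s & Bs]) =
    A `&` M (i + 1) @^-1` [set z].
  rewrite /= addrK event_cons setIC; congr (_ `&` _).
  by apply/seteqP; split => t /= /eqP.
rewrite mulrA -(markov_step Bs [::] s i z) -/A -AE -IH.
congr (pr P _); rewrite AE; apply/seteqP; split => t /=.
  by move=> [[? []]].
by move=> [[? Mt] ?]; do !split => //; rewrite /= Mt.
Qed.

(** Split according to the state at time -1, given which past and future are
    independent.  The boundary is at a fixed time, hence the factor depending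
    on the future does not depend on the length of the past, even when the
    chain is not homogeneous. *)
Lemma markov_finite_rank : exists past fut : seq (pred S) -> 'I_(size e) -> R,
  forall u w, pr P (event M (backward (-1) u ++ window 0 w)) =
    \sum_s past u s * fut w s.
Proof.
exists (fun u s => pr P (event M (backward (-1) u) `&`
  M (-1) @^-1` [set tnth (in_tuple e) s])).
exists (fun w s => future (-1) w (tnth (in_tuple e) s)) => u w.
rewrite (pr_sum (g := M (-1)) P e_uniq)// [LHS]big_tnth; apply: eq_bigr => j _.
set s := tnth _ _; rewrite event_cat setIAC.
case: u => [|B u].
  have -> : event M (backward (-1) [::]) `&` M (-1) @^-1` [set s] =
      event M (backward (-1) [:: xpred1 s]).
    apply/seteqP; split => t; rewrite /event /= andbT; last by move/eqP.
    by case=> _ ->.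
  exact: markov_future.
have [Bs|/negbTE Bs] := boolP (B s).
  have -> : event M (backward (-1) (B :: u)) `&` M (-1) @^-1` [set s] =
      event M (backward (-1) (xpred1 s :: u)).
    apply/seteqP; split => t; rewrite /event /=.
      by move=> [/andP[_ ->] ->]; rewrite eqxx.
    by move=> /andP[/eqP -> ->]; rewrite Bs.
  exact: markov_future.
have -> : event M (backward (-1) (B :: u)) `&` M (-1) @^-1` [set s] = set0.
  apply/seteqP; split => t //; rewrite /event /=.
  by move=> [/andP[+ _] Mt]; rewrite Mt Bs.
by rewrite set0I /pr measure0 mul0r.
Qed.

End markov.

(** * Word probabilities of a hidden-Markov coloring *)

Section word_probability.
Context (d : measure_display) (T : measurableType d) (R : realType)
  (P : probability T R).
Variable X : int -> {RV P >-> nat}.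
Hypothesis sX : stationary X.

Let mN (A : set nat) : measurable A. Proof. by []. Qed.

Definition cylinder (i : int) (w : seq nat) : seq (int * pred nat) :=
  window i [seq xpred1 a | a <- w].

Definition word_prob (w : seq nat) : R := pr P (event X (cylinder 0 w)).

Lemma cylinder_cat i u v :
  cylinder i (u ++ v) = cylinder i u ++ cylinder (i + (size u)%:Z) v.
Proof. by rewrite /cylinder map_cat window_cat size_map. Qed.

Lemma word_prob_shift i w : pr P (event X (cylinder i w)) = word_prob w.
Proof. exact: stationary_window. Qed.

Lemma word_prob_nil : word_prob [::] = 1.
Proof.
rewrite /word_prob [event _ _](_ : _ = setT) /pr ?probability_setT//.
exact/seteqP.
Qed.

(** By stationarity of X the word x ++ y can be placed so that x ends at time
    -1, where the boundary has to be for [markov_finite_rank]. *)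
Lemma hidden_markov_finite_rank (d'' : measure_display)
    (S : measurableType d'') (M : int -> {RV P >-> S}) (f : S -> nat) :
  finite_discrete S -> markov_chain M -> (forall i t, X i t = f (M i t)) ->
  exists n (past fut : seq nat -> 'I_n -> R),
    forall x y, word_prob (x ++ y) = \sum_s past x s * fut y s.
Proof.
move=> [finS mS] markovM Xf.
have [e0 e0E] := (finite_seqP _).1 finS.
have e_full s : s \in undup e0.
  have : [set: S] s by [].
  by rewrite e0E mem_undup.
have [past [fut rankM]] :=
  markov_finite_rank mS (undup_uniq e0) e_full markovM.
pose lift_word (w : seq nat) : seq (pred S) :=
  [seq (fun s => f s == a) | a <- w].
exists (size (undup e0)), (fun x => past (rev (lift_word x))),
  (fun y => fut (lift_word y)) => x y.
rewrite -rankM -(word_prob_shift (- (size x)%:Z)) cylinder_cat addNr.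
rewrite /cylinder !event_cat.
have XM i w : event X (window i [seq xpred1 a | a <- w]) =
    event M (window i (lift_word w)).
  elim: w i => [|a w IH] i; first by apply/seteqP.
  rewrite /= !event_cons IH; congr (_ `&` _).
  by apply/funext => t /=; rewrite Xf.
rewrite !XM -[- _]add0r -(size_map (fun a s => f s == a) x).
by rewrite event_window_rev.
Qed.

Variable q : nat.
Hypothesis coloringX : coloring q X.

Lemma split_color (j : int) l :
  \sum_(a <- iota 1 q) pr P (event X ((j, xpred1 a) :: l)) = pr P (event X l).
Proof.
rewrite (pr_sum (g := X j) P (iota_uniq 1 q) (A := event X l)).
- apply: eq_bigr => a _; rewrite event_cons setIC; congr (pr P (_ `&` _)).
  by apply/seteqP; split => t /= /eqP.
- exact: measurable_event.
- by move=> z; exact: (measurable_funPTI (X j)).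
- by move=> t _; rewrite mem_iota add1n ltnS; exact: coloringX.1.
Qed.

Lemma word_prob_rcons u :
  \sum_(a <- iota 1 q) word_prob (rcons u a) = word_prob u.
Proof.
rewrite /word_prob -(split_color (size u)%:Z); apply: eq_bigr => a _.
by rewrite -cats1 cylinder_cat add0r !event_cat setIC -event_cat.
Qed.

Lemma word_prob_repeat a u v : word_prob (u ++ [:: a, a & v]) = 0.
Proof.
have [N [mN0 N0 sub]] := coloringX.2.
rewrite /word_prob cylinder_cat add0r.
apply: (pr_le0 _ mN0); first exact: measurable_event; last by rewrite /pr N0.
move=> t; rewrite event_cat => -[_ /and3P[/eqP Xa /eqP Xa' _]].
by apply: sub => /(_ (size u)%:Z); rewrite Xa Xa'; apply.
Qed.

Lemma gap_sumE m u v : gap_sum word_prob (iota 1 q) m u v =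
  pr P (event X (cylinder 0 u ++ cylinder ((size u)%:Z + m%:Z) v)).
Proof.
elim: m u v => [|m IH] u v /=.
  by rewrite /word_prob cylinder_cat add0r addr0.
rewrite -(split_color (size u)%:Z); apply: eq_bigr => a _.
rewrite IH -cats1 cylinder_cat add0r size_cat PoszD -addrA -intS.
rewrite -catA [in RHS]event_cons !event_cat setICA; congr (pr P (_ `&` _)).
by apply/funext => t; rewrite /event /= andbT.
Qed.

(** A gap of length |k| + 1 is long enough whatever the sign of k; it is written
    as a successor since a rank-one power of the transfer matrix is needed with
    a positive exponent. *)
Lemma finitely_dependent_gap_sum : finitely_dependent X -> exists K, forall u v,
  gap_sum word_prob (iota 1 q) K.+1 u v = word_prob u * word_prob v.
Proof.
move=> [k kX]; exists (absz k) => u v.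
rewrite gap_sumE (k_dependent_event (i := (size u)%:Z) mN kX).
- by rewrite (word_prob_shift _ v).
- suff: forall (w : seq nat) i,
      all (fun c => c.1 < i + (size w)%:Z) (cylinder i w).
    by move=> /(_ u 0); rewrite add0r.
  elim=> [//|a w IH] i /=; rewrite -[window _ _]/(cylinder _ w).
  rewrite ltrDl ltz_nat /= intS addrA; exact: IH.
- suff: forall (w : seq nat) i j, j <= i ->
      all (fun c => j <= c.1) (cylinder i w) by apply; lia.
  elim=> [//|a w IH] i j ji /=; rewrite ji -[window _ _]/(cylinder _ w).
  by apply: IH; lia.
Qed.

End word_probability.

Theorem proposition3 (q : nat) (q_gt0 : (0 < q)%N) (R : realType)
    (d : measure_display) (T : measurableType d) (P : probability T R) :
  ~ (exists X : int -> {RV P >-> nat},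
       [/\ hidden_markov X, finitely_dependent X & coloring q X]).
Proof.
move=> [X [[sX [d'' [S [M [f [finS markovM _ Xf]]]]]] depX colX]].
have [n [past [fut rankX]]] := hidden_markov_finite_rank sX finS markovM Xf.
have [K gapX] := finitely_dependent_gap_sum sX colX depX.
exact: (no_finite_rank_coloring rankX (word_prob_nil X) (word_prob_rcons colX)
  (word_prob_repeat colX) gapX).
Qed.
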